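(* The category of tame relations $\mathrm{TRel}(\mathbf{PoSets},\mathrm{cp}_\perp)$, for the symmetric comparison cluster $\big(\mathrm{cp}_\perp\colon X\times X\to 2\big)_X$ indexed by orthomodular lattices $X$ and given by orthogonality of orthocomplements, is the category $\mathbf{OMLatGal}$ of orthomodular lattices and (antitone) Galois connections between them.
   Context: $\mathbf{PoSets}$ is the category of posets and monotone maps, with cartesian products $(\times,1)$ as symmetric monoidal structure, and here with the trivial (identity) involution. $2=\{0,1\}$ with $0\le 1$. For an orthomodular lattice $X$ with orthocomplement $(-)^\perp$, the map $\mathrm{cp}_\perp\colon X\times X\to 2$ is given by $\mathrm{cp}_\perp(x,y)=1$ iff $x^\perp\le y$ (equivalently, iff $x^\perp$ and $y^\perp$ are orthogonal). $\mathrm{TRel}(\mathbf{PoSets},\mathrm{cp}_\perp)$ is the following dagger category. Objects are orthomodular lattices. Morphisms $X\to Y$ are tame relations: monotone maps $r\colon X\times Y\to 2$ for which there are (necessarily unique) monotone maps $r_*\colon X\to Y$ and $r^*\colon Y\to X$ with $\mathrm{cp}_\perp(r_*(x),y)=r(x,y)=\mathrm{cp}_\perp(x,r^*(y))$ for all $x\in X,y\in Y$. The identity on $X$ is $\mathrm{cp}_\perp$, composition is $(s\bullet r)(x,z)=s(r_*(x),z)$, and the dagger is $r^\dagger(y,x)=\mathrm{cp}_\perp(r^*(y),x)$. $\mathbf{OMLatGal}$: objects are orthomodular lattices; morphisms $X\to Y$ are antitone Galois connections, i.e. pairs of order-reversing maps $f_\#\colon X\to Y$, $f^\#\colon Y\to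 X$ with $x\le f^\#(y)\iff y\le f_\#(x)$. The identity on $X$ is $((-)^\perp,(-)^\perp)$, composition is $(g\circ f)_\#=g_\#\circ(-)^\perp\circ f_\#$, $(g\circ f)^\#=f^\#\circ(-)^\perp\circ g^\#$, and the dagger interchanges $f_\#$ and $f^\#$. ''Is'' means isomorphic as (dagger) categories, identically on objects. *)

(* Defs.v *)
From HB Require Import structures.
From mathcomp Require Import all_boot all_order.
From mathcomp Require Import boolp.

Set Implicit Arguments.
Unset Strict Implicit.
Unset Printing Implicit Defensive.

Import Order.TTheory.
Local Open Scope order_scope.

(* Dagger categories with a given collection of objects, so that functors
   which are the identity on objects need no transport of morphisms. *)

Record dagger_category (Ob : Type) := DaggerCategory {
  hom :> Ob -> Ob -> Type;
  idm : forall X, hom X X;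
  mcomp : forall X Y Z, hom Y Z -> hom X Y -> hom X Z;
  dag : forall X Y, hom X Y -> hom Y X;
  comp1m : forall X Y (f : hom X Y), mcomp (idm Y) f = f;
  compm1 : forall X Y (f : hom X Y), mcomp f (idm X) = f;
  compA : forall W X Y Z (h : hom Y Z) (g : hom X Y) (f : hom W X),
    mcomp h (mcomp g f) = mcomp (mcomp h g) f;
  dag1 : forall X, dag (idm X) = idm X;
  dagM : forall X Y Z (g : hom Y Z) (f : hom X Y),
    dag (mcomp g f) = mcomp (dag f) (dag g);
  dagK : forall X Y (f : hom X Y), dag (dag f) = f
}.
Arguments idm {Ob d} X.
Arguments mcomp {Ob d X Y Z}.
Arguments dag {Ob d X Y}.

Record dagger_functor_over (Ob : Type) (C D : dagger_category Ob) :=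
  DaggerFunctorOver {
    fmap :> forall X Y, C X Y -> D X Y;
    fmap1 : forall X, fmap (idm X) = idm X;
    fmapM : forall X Y Z (g : C Y Z) (f : C X Y),
      fmap (mcomp g f) = mcomp (fmap g) (fmap f);
    fmap_dag : forall X Y (f : C X Y), fmap (dag f) = dag (fmap f)
  }.

Definition dagger_isomorphic_over (Ob : Type) (C D : dagger_category Ob) :=
  exists (F : dagger_functor_over C D) (G : dagger_functor_over D C),
    (forall X Y (f : C X Y), G X Y (F X Y f) = f) /\
    (forall X Y (g : D X Y), F X Y (G X Y g) = g).

(* PoSets: a morphism is an {omorphism X -> Y}, and 2 is bool with
   false <= true. A porderType has a boolean order and a choice structure;
   under the classical axioms of boolp every poset is of this form. *)

Definition omorph d1 (T1 : porderType d1) d2 (T2 : porderType d2)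
    (f : T1 -> T2) (fle : {homo f : x y / x <= y}) : {omorphism T1 -> T2} :=
  HB.pack f (Order.isOrderMorphism.Build d1 T1 d2 T2 f fle).

Lemma omorph_ext d1 (T1 : porderType d1) d2 (T2 : porderType d2)
  (f g : {omorphism T1 -> T2}) : f =1 g -> f = g.
Proof.
case: f => f [[hf]]; case: g => g [[hg]] /= /funext fg.
by move: fg hf hg => /= <- hf hg; rewrite (Prop_irrelevance hf hg).
Qed.

(* A comparison cluster must determine elements by their comparisons; this is
   what makes the maps r_* and r^* of a tame relation r unique. *)
Record sym_comparison_cluster (d : Order.disp_t) := SymComparisonCluster {
  cidx : Type;
  cpo : cidx -> porderType d;
  cp : forall i, {omorphism (cpo i *p cpo i) -> bool};
  cpC : forall i (x y : cpo i), cp i (x, y) = cp i (y, x);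
  cp_inj : forall i (x x' : cpo i),
    (forall y, cp i (x, y) = cp i (x', y)) -> x = x'
}.

Section TameRelations.
Context {d : Order.disp_t} (K : sym_comparison_cluster d).
Implicit Types X Y Z W : cidx K.

Definition tame X Y (r : {omorphism (cpo X *p cpo Y) -> bool}) : Prop :=
  exists (f : {omorphism cpo X -> cpo Y}) (g : {omorphism cpo Y -> cpo X}),
    forall x y, cp Y (f x, y) = r (x, y) /\ r (x, y) = cp X (x, g y).

Record tame_rel X Y := TameRel {
  trel :> {omorphism (cpo X *p cpo Y) -> bool};
  trel_tame : tame trel
}.

Lemma trel_ext X Y (r s : tame_rel X Y) :
  (forall x y, r (x, y) = s (x, y)) -> r = s.
Proof.
case: r => r hr; case: s => s hs /= rs.
have {}rs : r = s by apply: omorph_ext => -[].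
by move: rs hr hs => <- hr hs; rewrite (Prop_irrelevance hr hs).
Qed.

(* lower r is r_* and upper r is r^*; they are unique, see below. *)
Definition lower X Y (r : tame_rel X Y) : {omorphism cpo X -> cpo Y} :=
  projT1 (cid (trel_tame r)).

Definition upper X Y (r : tame_rel X Y) : {omorphism cpo Y -> cpo X} :=
  projT1 (cid (projT2 (cid (trel_tame r)))).

Lemma lowerP X Y (r : tame_rel X Y) x y : cp Y (lower r x, y) = r (x, y).
Proof.
by case: (projT2 (cid (projT2 (cid (trel_tame r)))) x y).
Qed.

Lemma upperP X Y (r : tame_rel X Y) x y : r (x, y) = cp X (x, upper r y).
Proof.
by case: (projT2 (cid (projT2 (cid (trel_tame r)))) x y).
Qed.

Lemma lower_unique X Y (r : tame_rel X Y) (f : {omorphism cpo X -> cpo Y}) :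
  (forall x y, cp Y (f x, y) = r (x, y)) -> f = lower r.
Proof.
by move=> fr; apply: omorph_ext => x; apply: cp_inj => y; rewrite fr lowerP.
Qed.

Lemma upper_unique X Y (r : tame_rel X Y) (g : {omorphism cpo Y -> cpo X}) :
  (forall x y, r (x, y) = cp X (x, g y)) -> g = upper r.
Proof.
move=> gr; apply: omorph_ext => y; apply: cp_inj => x.
by rewrite cpC -gr upperP cpC.
Qed.

Lemma cp_tame X : tame (cp X).
Proof. by exists (omorph (fun _ _ => id)), (omorph (fun _ _ => id)). Qed.

Definition trel_id X : tame_rel X X := TameRel (cp_tame X).

Fact trel_comp_homo X Y Z (s : tame_rel Y Z) (r : tame_rel X Y) :
  {homo (fun p : cpo X *p cpo Z => s (lower r p.1, p.2)) : p q / p <= q}.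
Proof.
move=> p q; rewrite leEprod => /andP[p1 p2].
by apply: omorph_le; rewrite leEprod /= p2 andbT; apply: omorph_le.
Qed.

Fact trel_comp_tame X Y Z (s : tame_rel Y Z) (r : tame_rel X Y) :
  tame (omorph (trel_comp_homo s r)).
Proof.
exists (lower s \o lower r), (upper r \o upper s) => x z /=.
by rewrite lowerP upperP lowerP upperP.
Qed.

Definition trel_comp X Y Z (s : tame_rel Y Z) (r : tame_rel X Y) :
  tame_rel X Z := TameRel (trel_comp_tame s r).

Fact trel_dag_homo X Y (r : tame_rel X Y) :
  {homo (fun p : cpo Y *p cpo X => cp X (upper r p.1, p.2)) : p q / p <= q}.
Proof.
move=> p q; rewrite leEprod => /andP[p1 p2].
by apply: omorph_le; rewrite leEprod /= p2 andbT; apply: omorph_le.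
Qed.

Fact trel_dag_tame X Y (r : tame_rel X Y) : tame (omorph (trel_dag_homo r)).
Proof.
exists (upper r), (lower r) => y x /=; split=> //.
by rewrite cpC -upperP -lowerP cpC.
Qed.

Definition trel_dag X Y (r : tame_rel X Y) : tame_rel Y X :=
  TameRel (trel_dag_tame r).

Lemma trel_dagE X Y (r : tame_rel X Y) y x : trel_dag r (y, x) = r (x, y).
Proof. by rewrite /= cpC -upperP. Qed.

Lemma lower_id X x : lower (trel_id X) x = x.
Proof. by apply: cp_inj => y; rewrite lowerP. Qed.

Lemma lower_comp X Y Z (s : tame_rel Y Z) (r : tame_rel X Y) x :
  lower (trel_comp s r) x = lower s (lower r x).
Proof. by apply: cp_inj => z; rewrite !lowerP. Qed.

Lemma lower_dag X Y (r : tame_rel X Y) y : lower (trel_dag r) y = upper r y.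
Proof. by apply: cp_inj => x; rewrite lowerP. Qed.

Definition TRel : dagger_category (cidx K).
Proof.
refine (@DaggerCategory _ tame_rel trel_id trel_comp trel_dag _ _ _ _ _ _).
- by move=> X Y r; apply: trel_ext => x y /=; rewrite lowerP.
- by move=> X Y r; apply: trel_ext => x y /=; rewrite lower_id.
- by move=> W X Y Z t s r; apply: trel_ext => x y /=; rewrite lower_comp.
- by move=> X; apply: trel_ext => x y; rewrite trel_dagE; apply: cpC.
- move=> X Y Z s r; apply: trel_ext => z x; rewrite trel_dagE.
  by rewrite [LHS](upperP s) lowerP -lower_dag; apply/esym/trel_dagE.
- by move=> X Y r; apply: trel_ext => x y; rewrite !trel_dagE.
Defined.

End TameRelations.

HB.mixin Record isOrthomodular d T of Order.TBLattice d T := {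
  perp : T -> T;
  perpK : involutive perp;
  perp_anti : {homo perp : x y /~ x <= y};
  meet_perp : forall x, x `&` perp x = \bot;
  join_perp : forall x, x `|` perp x = \top;
  orthomodular_law : forall x y, x <= y ->
    y = x `|` (perp x `&` y)
}.

(* The display d is only a notational tag: Order.disp_t has a single element,
   so for any d these are all the orthomodular lattices. *)
#[short(type="omlatType")]
HB.structure Definition OrthomodularLattice d :=
  { T of isOrthomodular d T & Order.TBLattice d T }.

Section OrthomodularLattices.
Context {d : Order.disp_t}.
Implicit Types X Y Z W : omlatType d.

Lemma perp_le X (x y : X) : (perp x <= y) = (perp y <= x).
Proof. by apply/idP/idP => /perp_anti; rewrite perpK. Qed.

Lemma le_perp X (x y : X) : (x <= perp y) = (y <= perp x).
Proof. by apply/idP/idP => /perp_anti; rewrite perpK. Qed.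

Fact cp_perp_homo X :
  {homo (fun p : X *p X => perp p.1 <= p.2) : p q / p <= q}.
Proof.
move=> p q; rewrite leEprod => /andP[p1 p2]; rewrite leEbool.
case h: (perp p.1 <= p.2) => //.
by rewrite (le_trans (perp_anti _ _ p1) (le_trans h p2)).
Qed.

Definition cp_perp X : {omorphism (X *p X) -> bool} := omorph (@cp_perp_homo X).

Lemma cp_perpC X (x y : X) : cp_perp X (x, y) = cp_perp X (y, x).
Proof. exact: perp_le. Qed.

Lemma cp_perp_inj X (x x' : X) :
  (forall y, cp_perp X (x, y) = cp_perp X (x', y)) -> x = x'.
Proof.
move=> h; apply: (can_inj (@perpK _ X)); apply/le_anti/andP; split.
  by have /= -> := h (perp x').
by have /= <- := h (perp x).
Qed.

(* gal_lower is f_# and gal_upper is f^#. *)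
Record antitone_galois X Y := AntitoneGalois {
  gal_lower : X -> Y;
  gal_upper : Y -> X;
  gal_lower_anti : {homo gal_lower : x x' /~ x <= x'};
  gal_upper_anti : {homo gal_upper : y y' /~ y <= y'};
  gal_adj : forall x y, (x <= gal_upper y) = (y <= gal_lower x)
}.

Lemma gal_ext X Y (f g : antitone_galois X Y) :
  gal_lower f =1 gal_lower g -> gal_upper f =1 gal_upper g -> f = g.
Proof.
case: f => fl fu a b c; case: g => gl gu a' b' c' /= /funext fg /funext fg'.
move: a b c a' b' c'; rewrite fg fg' => a b c a' b' c'.
by rewrite (Prop_irrelevance a a') (Prop_irrelevance b b') (Prop_irrelevance c c').
Qed.

Definition gal_id X : antitone_galois X X :=
  AntitoneGalois (@perp_anti _ X) (@perp_anti _ X) (@le_perp X).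

Definition gal_comp X Y Z (g : antitone_galois Y Z) (f : antitone_galois X Y) :
  antitone_galois X Z.
Proof.
refine (@AntitoneGalois X Z (gal_lower g \o @perp _ Y \o gal_lower f)
          (gal_upper f \o @perp _ Y \o gal_upper g) _ _ _).
- by move=> x x' h; apply/gal_lower_anti/perp_anti/gal_lower_anti.
- by move=> z z' h; apply/gal_upper_anti/perp_anti/gal_upper_anti.
- by move=> x z /=; rewrite gal_adj perp_le gal_adj.
Defined.

Definition gal_dag X Y (f : antitone_galois X Y) : antitone_galois Y X :=
  AntitoneGalois (@gal_upper_anti X Y f) (@gal_lower_anti X Y f)
    (fun y x => esym (gal_adj f x y)).

End OrthomodularLattices.

Definition cp_perp_cluster (d : Order.disp_t) : sym_comparison_cluster d :=
  @SymComparisonCluster d (omlatType d) (fun X => X) (@cp_perp d)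
    (@cp_perpC d) (@cp_perp_inj d).

Definition OMLatGal (d : Order.disp_t) : dagger_category (omlatType d).
Proof.
refine (@DaggerCategory _ antitone_galois gal_id (@gal_comp d) (@gal_dag d)
          _ _ _ _ _ _).
- by move=> X Y f; apply: gal_ext => x //=; rewrite perpK.
- by move=> X Y f; apply: gal_ext => x //=; rewrite perpK.
- by move=> W X Y Z h g f; apply: gal_ext.
- by move=> X; apply: gal_ext.
- by move=> X Y Z g f; apply: gal_ext.
- by move=> X Y f; apply: gal_ext.
Defined.

(* Main.v *)
Require Import Defs.
From mathcomp Require Import all_boot all_order.

(* A tame relation r corresponds to the Galois connection with
   f_# x = r_* (x^perp) and f^# y = r^* (y^perp): unfolding cp_perp, both
   y <= f_# x and x <= f^# y say that r holds at (x^perp, y^perp). *)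

Set Implicit Arguments.
Unset Strict Implicit.
Unset Printing Implicit Defensive.

Import Order.TTheory.
Local Open Scope order_scope.

Section TameRelationsAndGaloisConnections.
Context {d : Order.disp_t}.
Implicit Types X Y Z : omlatType d.
Local Notation K := (cp_perp_cluster d).

Lemma le_lower_perp X Y (r : @tame_rel d K X Y) (x : X) (y : Y) :
  (y <= lower r (perp x)) = r (perp x, perp y).
Proof. by rewrite -lowerP /= perp_le perpK. Qed.

Lemma le_upper_perp X Y (r : @tame_rel d K X Y) (x : X) (y : Y) :
  (x <= upper r (perp y)) = r (perp x, perp y).
Proof. by rewrite upperP /= perpK. Qed.

Definition gal_of_trel X Y (r : @tame_rel d K X Y) : antitone_galois X Y.
Proof.
refine (@AntitoneGalois d X Y (lower r \o @perp _ X) (upper r \o @perp _ Y)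
          _ _ _).
- by move=> x x' h; apply/omorph_le/perp_anti.
- by move=> y y' h; apply/omorph_le/perp_anti.
- by move=> x y /=; rewrite le_upper_perp le_lower_perp.
Defined.

Section TrelOfGal.
Variables (X Y : omlatType d) (g : antitone_galois X Y).

Fact gal_lower_perp_homo :
  {homo (gal_lower g \o @perp _ X) : x x' / x <= x'}.
Proof. by move=> x x' h; apply/gal_lower_anti/perp_anti. Qed.

Fact gal_upper_perp_homo :
  {homo (gal_upper g \o @perp _ Y) : y y' / y <= y'}.
Proof. by move=> y y' h; apply/gal_upper_anti/perp_anti. Qed.

(** This is [cp_perp] at [(gal_lower g (perp x), y)] with the complement moved onto [y]; in this
    form [gal_adj] turns it into [cp_perp] at [(x, gal_upper g (perp y))]. *)
Fact gal_rel_homo :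
  {homo (fun p : X *p Y => perp p.2 <= gal_lower g (perp p.1)) :
    p q / p <= q}.
Proof.
move=> p q; rewrite leEprod => /andP[p1 p2]; rewrite leEbool.
case h: (perp p.2 <= gal_lower g (perp p.1)) => //.
by rewrite (le_trans (perp_anti _ _ p2) (le_trans h (gal_lower_perp_homo p1))).
Qed.

Fact gal_rel_tame : @tame d K X Y (omorph gal_rel_homo).
Proof.
exists (omorph gal_lower_perp_homo), (omorph gal_upper_perp_homo) => x y /=.
by rewrite perp_le gal_adj.
Qed.

Definition trel_of_gal : @tame_rel d K X Y := TameRel gal_rel_tame.

(** Since [lower] is obtained by choice from tameness, it does not reduce to the witness given
    above; [cp_inj] identifies the two. *)
Lemma lower_trel_of_gal x : lower trel_of_gal x = gal_lower g (perp x).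
Proof.
by apply: (@cp_inj d K Y) => y; rewrite lowerP /= perp_le.
Qed.

Lemma upper_trel_of_gal y : upper trel_of_gal y = gal_upper g (perp y).
Proof.
(* Cancellation acts on the first argument of [cp], whereas [upperP] has [upper] in the second,
   hence the swap by symmetry. *)
by apply: (@cp_inj d K X) => x; rewrite cpC -upperP /= [RHS]perp_le gal_adj.
Qed.

End TrelOfGal.

Lemma gal_of_trelK X Y : cancel (@gal_of_trel X Y) (@trel_of_gal X Y).
Proof.
move=> r; apply: trel_ext => x y; rewrite -lowerP lower_trel_of_gal /= perpK.
exact: (lowerP r).
Qed.

Lemma trel_of_galK X Y : cancel (@trel_of_gal X Y) (@gal_of_trel X Y).
Proof.
move=> g; apply: gal_ext => z /=.
  by rewrite lower_trel_of_gal perpK.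
by rewrite upper_trel_of_gal perpK.
Qed.

(** Adjoints are unique: [gal_adj] expresses the lower set of each [gal_upper f y] through
    [gal_lower f]. Thus functor laws need checking on lower maps only. *)
Lemma gal_lower_inj X Y (f g : antitone_galois X Y) :
  gal_lower f =1 gal_lower g -> f = g.
Proof.
move=> fg; apply: gal_ext => // y; apply/le_anti/andP; split.
  by rewrite gal_adj -fg -gal_adj.
by rewrite gal_adj fg -gal_adj.
Qed.

Definition gal_functor : dagger_functor_over (TRel K) (OMLatGal d).
Proof.
refine (@DaggerFunctorOver _ (TRel K) (OMLatGal d) gal_of_trel _ _ _).
- by move=> X; apply: gal_lower_inj => x; apply: (@lower_id d K).
- move=> X Y Z s r; apply: gal_lower_inj => x /=.
  (* The complement inserted by composition in [OMLatGal] cancels the one that precedes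
     [lower s]. *)
  by rewrite perpK; apply: (@lower_comp d K).
- by move=> X Y r; apply: gal_lower_inj => y; apply: (@lower_dag d K).
Defined.

(** The inverse of a functor bijective on morphisms is again a functor: each law is tested after
    applying the injective [gal_of_trel], where it becomes the law for [gal_functor]. *)
Definition trel_functor : dagger_functor_over (OMLatGal d) (TRel K).
Proof.
refine (@DaggerFunctorOver _ (OMLatGal d) (TRel K) trel_of_gal _ _ _).
- move=> X; apply: (can_inj (@gal_of_trelK X X)).
  by rewrite trel_of_galK -(fmap1 gal_functor).
- move=> X Y Z g f; apply: (can_inj (@gal_of_trelK X Z)).
  rewrite trel_of_galK -[RHS]/(gal_functor _ _ _) fmapM /=.
  by rewrite !trel_of_galK.
- move=> X Y f; apply: (can_inj (@gal_of_trelK Y X)).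
  rewrite trel_of_galK -[RHS]/(gal_functor _ _ _) fmap_dag /=.
  by rewrite trel_of_galK.
Defined.

End TameRelationsAndGaloisConnections.

Theorem proposition4p1 (d : Order.disp_t) :
  dagger_isomorphic_over (TRel (cp_perp_cluster d)) (OMLatGal d).
Proof.
exists gal_functor, trel_functor; split=> X Y f.
  exact: gal_of_trelK.
exact: trel_of_galK.
Qed.
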